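(* The regular icosahedron, the rhombicuboctahedron, the icosidodecahedron, the truncated dodecahedron, the truncated icosahedron, the truncated icosidodecahedron, the rhombicosidodecahedron, the snub cube and the snub dodecahedron are not orthogonally decomposable.
   Context: A polygonal path in $\mathbb{R}^3$ is orthogonal if each of its edges is parallel to one of the coordinate axes. A set $S\subset\mathbb{R}^3$ is orthogonally connected if any two distinct points of $S$ are joined by an orthogonal path contained in $S$. A polytope is decomposed into polytopes $P_1,\dots,P_k$ if it is their union and their interiors are pairwise disjoint. A polytope in $\mathbb{R}^3$ is orthogonally decomposable if it can be decomposed into finitely many polytopes with orthogonally connected boundaries. By convention a suitable rotation is allowed: $P$ is orthogonally decomposable if some rotated copy of $P$ has such a decomposition, and not orthogonally decomposable if no rotated copy of $P$ has one. The Archimedean solids named have the following vertex configurations: rhombicuboctahedron $3.4.4.4$, icosidodecahedron $3.5.3.5$, truncated dodecahedron $3.10.10$, truncated icosahedron $5.6.6$, truncated icosidodecahedron $4.6.10$, rhombicosidodecahedron $3.4.5.4$, snub cube $3.3.3.3.4$, snub dodecahedron $3.3.3.3.5$. *)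

(* Defs.v *)
From HB Require Import structures.
From mathcomp Require Import all_boot all_order all_algebra perm.
From mathcomp Require Import all_classical all_reals all_analysis.
Set Implicit Arguments.
Unset Strict Implicit.
Unset Printing Implicit Defensive.
Import Order.TTheory GRing.Theory Num.Theory.
Import numFieldNormedType.Exports.

Local Open Scope classical_set_scope.
Local Open Scope ring_scope.

Section OrthogonalConnectedness.
Variable R : realType.
Local Notation E3 := 'rV[R]_3.

Definition segment (x y : E3) : set E3 :=
  [set (1 - t) *: x + t *: y | t in `[0, 1]].

Definition axis_parallel (x y : E3) : Prop :=
  exists i : 'I_3, forall j : 'I_3, j != i -> x 0 j = y 0 j.

Definition orthogonal_path_in (S : set E3) (n : nat) (p : nat -> E3) : Prop :=
  forall k, (k < n)%N ->
    axis_parallel (p k) (p k.+1) /\ segment (p k) (p k.+1) `<=` S.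

Definition orthogonally_connected (S : set E3) : Prop :=
  forall x y, S x -> S y -> x <> y ->
    exists n (p : nat -> E3),
      [/\ p 0%N = x, p n = y & orthogonal_path_in S n p].

Definition boundary (S : set E3) : set E3 := closure S `\` interior S.

Definition convex_hull (V : set E3) : set E3 :=
  smallest (@convex_set R E3) V.

Definition polytope (P : set E3) : Prop :=
  exists2 V : set E3, finite_set V & P = convex_hull V.

Definition decomposition (P : set E3) (k : nat) (Q : 'I_k -> set E3) : Prop :=
  [/\ forall i, polytope (Q i),
      P = \bigcup_i Q i
    & forall i j, i != j -> interior (Q i) `&` interior (Q j) = set0].

Definition rotation_mx (A : 'M[R]_3) : Prop := A *m A^T = 1%:M /\ \det A = 1.

Definition orthogonally_decomposable (P : set E3) : Prop :=
  exists A : 'M[R]_3, rotation_mx A /\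
    exists k (Q : 'I_k -> set E3),
      decomposition [set x *m A | x in P] Q /\
      forall i, orthogonally_connected (boundary (Q i)).

End OrthogonalConnectedness.

(* Each solid below is, up to similarity, the convex hull of a union of orbits
   of points under a group of signed coordinate permutations. *)
Section Solids.
Variable R : realType.
Local Notation E3 := 'rV[R]_3.

Definition pt (a b c : R) : E3 := \row_(i < 3) [:: a; b; c]`_i.

Definition signed_perm (s : 'S_3) (e : {ffun 'I_3 -> bool}) (u : E3) : E3 :=
  \row_i ((-1) ^+ e i * u 0 (s i)).

Definition odd_signs (e : {ffun 'I_3 -> bool}) : bool := \big[addb/false]_i e i.

Definition orbits (G : 'S_3 -> {ffun 'I_3 -> bool} -> bool) (us : seq E3) :
    set E3 :=
  [set v | exists u s e, [/\ u \in us, G s e & v = signed_perm s e u]].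

(* [all_signed] is the full octahedral group, [even_signed] the pyritohedral
   group; [octahedral_rot] and [tetrahedral_rot] are their rotation subgroups:
   the signed permutation matrix of (s, e) has determinant
   (-1) ^+ (odd_perm s + odd_signs e). *)
Definition all_signed (s : 'S_3) (e : {ffun 'I_3 -> bool}) : bool := true.
Definition even_signed (s : 'S_3) (e : {ffun 'I_3 -> bool}) : bool :=
  ~~ odd_perm s.
Definition octahedral_rot (s : 'S_3) (e : {ffun 'I_3 -> bool}) : bool :=
  odd_perm s == odd_signs e.
Definition tetrahedral_rot (s : 'S_3) (e : {ffun 'I_3 -> bool}) : bool :=
  ~~ odd_perm s && ~~ odd_signs e.

(* [A] may be a reflection, so both enantiomorphs of the snub solids count. *)
Definition similar (P Q : set E3) : Prop :=
  exists (c : R) (A : 'M[R]_3) (b : E3),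
    [/\ 0 < c, A *m A^T = 1%:M & Q = [set c *: (x *m A) + b | x in P]].

Definition phi : R := (1 + Num.sqrt 5) / 2.

Definition regular_icosahedron (P : set E3) : Prop :=
  similar (convex_hull (orbits even_signed [:: pt 0 1 phi])) P.

Definition rhombicuboctahedron (P : set E3) : Prop :=
  similar (convex_hull (orbits all_signed [:: pt 1 1 (1 + Num.sqrt 2)])) P.

Definition icosidodecahedron (P : set E3) : Prop :=
  similar (convex_hull (orbits even_signed
    [:: pt 0 0 (2 * phi); pt 1 phi (phi ^+ 2)])) P.

Definition truncated_dodecahedron (P : set E3) : Prop :=
  similar (convex_hull (orbits even_signed
    [:: pt 0 phi^-1 (2 + phi);
        pt phi^-1 phi (2 * phi);
        pt phi 2 (phi + 1)])) P.

Definition truncated_icosahedron (P : set E3) : Prop :=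
  similar (convex_hull (orbits even_signed
    [:: pt 0 1 (3 * phi);
        pt 1 (2 + phi) (2 * phi);
        pt phi 2 (2 * phi + 1)])) P.

Definition truncated_icosidodecahedron (P : set E3) : Prop :=
  similar (convex_hull (orbits even_signed
    [:: pt phi^-1 phi^-1 (3 + phi);
        pt (2 * phi^-1) phi (1 + 2 * phi);
        pt phi^-1 (phi ^+ 2) (3 * phi - 1);
        pt (2 * phi - 1) 2 (2 + phi);
        pt phi 3 (2 * phi)])) P.

Definition rhombicosidodecahedron (P : set E3) : Prop :=
  similar (convex_hull (orbits even_signed
    [:: pt 1 1 (phi ^+ 3);
        pt (phi ^+ 2) phi (2 * phi);
        pt (2 + phi) 0 (phi ^+ 2)])) P.

(* [t] is the tribonacci constant, the only real root of its equation. *)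
Definition snub_cube (P : set E3) : Prop :=
  exists2 t : R, t ^+ 3 = t ^+ 2 + t + 1 &
    similar (convex_hull (orbits octahedral_rot [:: pt 1 t^-1 t])) P.

(* The usual Cartesian coordinates of the snub dodecahedron, in terms of the
   only real root xi = 1.7155... of the cubic in [snub_dodecahedron]. *)
Definition snub_dodecahedron_points (xi : R) : seq E3 :=
  let a := xi - xi^-1 in
  let b := xi * phi + phi ^+ 2 + phi / xi in
  [:: pt (2 * a) 2 (2 * b);
      pt (a + b / phi + phi) (- (a * phi) + b + phi^-1) (a / phi + b * phi - 1);
      pt (a + b / phi - phi) (a * phi - b + phi^-1) (a / phi + b * phi + 1);
      pt (- (a / phi) + b * phi + 1) (- a + b / phi - phi) (a * phi + b - phi^-1);
      pt (- (a / phi) + b * phi - 1) (a - b / phi - phi) (a * phi + b + phi^-1)].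

Definition snub_dodecahedron (P : set E3) : Prop :=
  exists2 xi : R, xi ^+ 3 - 2 * xi = phi &
    similar (convex_hull
      (orbits tetrahedral_rot (snub_dodecahedron_points xi))) P.

End Solids.

(* Main.v *)
Require Import Defs.
From HB Require Import structures.
From mathcomp Require Import all_boot all_order all_algebra perm.
From mathcomp Require Import all_classical all_reals all_analysis.
From mathcomp Require Import ring lra.
Set Implicit Arguments.
Unset Strict Implicit.
Unset Printing Implicit Defensive.
Import Order.TTheory GRing.Theory Num.Theory.
Import numFieldNormedType.Exports.
Local Open Scope classical_set_scope.
Local Open Scope ring_scope.

(** Idea of the proof.  Let a polytope be decomposed into pieces whose
    boundaries are orthogonally connected, and let [n] be the normal of one of
    its facets.  Some piece has three non-collinear points in that facet
    ([facet_normal_cover]), hence a facet (or is itself contained) in the same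
    plane.  An orthogonal path in the boundary of the piece that starts in the
    middle of this triangle must begin inside the plane, so [n] is perpendicular
    to a coordinate axis ([connected_facet_normal]).  Therefore a polytope can be
    orthogonally decomposable only if there is an orthonormal frame such that
    each facet normal is perpendicular to one of its three vectors
    ([decomposable_frame]).

    All nine solids are invariant under the rotations of the tetrahedron, and
    have facets perpendicular to the four diagonals of the cube.  The condition
    at these four normals leaves few frames, and each of these is excluded by
    the images of one further facet normal [pt p q r], provided that
    [p * (q ^+ 2 - r ^+ 2) != 0].  This is proved without enumerating frames, by
    computing with the cubic form that is the product of the three linear forms
    given by the frame ([no_frame]).

    It remains to exhibit two facets for each solid: one whose normal is
    [pt 1 1 1] and one with a normal as above.  Each is certified by a linear
    inequality satisfied at all vertices and three non-collinear vertices where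
    equality holds. *)

Lemma ord3P (i : 'I_3) : [\/ i = 0, i = 1 | i = 2%:R].
Proof.
by case: i => -[|[|[|//]]] i; [apply: Or31 | apply: Or32 | apply: Or33]; apply/val_inj.
Qed.

(** * Facets of convex sets *)

Section Facets.
Variable R : realType.
Local Notation E3 := 'rV[R]_3.
Implicit Types (u v w x y z p q r n : E3) (K C V : set E3).

Definition dot u v : R := (u *m v^T) 0 0.

Definition aff_indep p q r :=
  forall a b : R, a *: (q - p) + b *: (r - p) = 0 -> a = 0 /\ b = 0.

(** For a polytope [K] and a nonzero [n], this says that [n] is an outer normal
    of a two-dimensional face.  No convexity is asked of [K], so that the vertex
    set of a polytope can stand for the polytope itself. *)
Definition facet_normal K n :=
  exists c p q r,
    [/\ forall x, K x -> dot n x <= c,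
        [/\ K p, K q & K r],
        [/\ dot n p = c, dot n q = c & dot n r = c]
      & aff_indep p q r].

Lemma dotDr n x y : dot n (x + y) = dot n x + dot n y.
Proof. by rewrite /dot linearD mulmxDr mxE. Qed.

Lemma dotZr n (a : R) x : dot n (a *: x) = a * dot n x.
Proof. by rewrite /dot linearZ -scalemxAr mxE. Qed.

Lemma dotNr n x : dot n (- x) = - dot n x.
Proof. by rewrite /dot linearN mulmxN mxE. Qed.

Lemma dotE u v : dot u v = u 0 0 * v 0 0 + u 0 1 * v 0 1 + u 0 2%:R * v 0 2%:R.
Proof.
rewrite /dot mxE !big_ord_recl big_ord0 !mxE addr0 addrA.
by congr (_ * _ + _ * _ + _ * _); congr (_ _ _); apply/val_inj.
Qed.

Lemma convex_comb2 C x y (s t : R) : @convex_set R E3 C -> C x -> C y ->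
  0 <= s -> 0 <= t -> s + t = 1 -> C (s *: x + t *: y).
Proof.
move=> cC Cx Cy s0 t0 st.
have s1 : s <= 1 by lra.
have -> : t = 1 - s by lra.
by have := cC x y (Itv01 s0 s1); rewrite !inE; apply.
Qed.

Lemma convex_comb3 C x y z (s t u : R) : @convex_set R E3 C ->
  C x -> C y -> C z -> 0 < s -> 0 <= t -> 0 <= u -> s + t + u = 1 ->
  C (s *: x + t *: y + u *: z).
Proof.
move=> cC Cx Cy Cz s0 t0 u0 stu.
have st0 : s + t != 0 by lra.
have -> : s *: x + t *: y + u *: z =
    (s + t) *: ((s / (s + t)) *: x + (t / (s + t)) *: y) + u *: z.
  by rewrite scalerDr !scalerA !mulrA ![(s + t) * _]mulrC !mulfK.
apply: convex_comb2 => //; last by lra.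
apply: convex_comb2 => //; last by field.
- by apply: divr_ge0; lra.
- by apply: divr_ge0; lra.
Qed.

Lemma convex_comb4 C x y z w (s t u v : R) : @convex_set R E3 C ->
  C x -> C y -> C z -> C w -> 0 < s -> 0 <= t -> 0 <= u -> 0 <= v ->
  s + t + u + v = 1 -> C (s *: x + t *: y + u *: z + v *: w).
Proof.
move=> cC Cx Cy Cz Cw s0 t0 u0 v0 stuv.
have st0 : s + t != 0 by lra.
have -> : s *: x + t *: y + u *: z + v *: w =
    (s + t) *: ((s / (s + t)) *: x + (t / (s + t)) *: y) + u *: z + v *: w.
  by rewrite scalerDr !scalerA !mulrA ![(s + t) * _]mulrC !mulfK.
apply: convex_comb3 => //; try lra.
apply: convex_comb2 => //; last by field.
- by apply: divr_ge0; lra.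
- by apply: divr_ge0; lra.
Qed.

(** Expressing a vector in a basis is continuous: its coordinates are obtained
    by multiplying by the inverse of the matrix of the basis. *)
Lemma small_coordinates e1 e2 e3 (eta : R) : 0 < eta ->
  (forall a b c, a *: e1 + b *: e2 + c *: e3 = 0 -> [/\ a = 0, b = 0 & c = 0]) ->
  exists2 delta : R, 0 < delta &
    forall w, (forall j, `|w 0 j| < delta) -> exists a b c : R,
      w = a *: e1 + b *: e2 + c *: e3 /\
      [/\ `|a| <= eta, `|b| <= eta & `|c| <= eta].
Proof.
move=> eta0 ind.
pose E : 'M[R]_3 := \matrix_(i < 3) [:: e1; e2; e3]`_i.
have comb v : v *m E = v 0 0 *: e1 + v 0 1 *: e2 + v 0 2%:R *: e3.
  rewrite mulmx_sum_row !big_ord_recl big_ord0 addr0 addrA !rowK /=.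
  by congr (v _ _ *: _ + v _ _ *: _ + v _ _ *: _); apply/val_inj.
have Eu : E \in unitmx.
  rewrite -row_free_unit -kermx_eq0; apply/rowV0P => v /sub_kermxP.
  rewrite comb => /ind[v0 v1 v2]; apply/rowP => j; rewrite mxE.
  by case: (ord3P j) => ->.
pose M := \sum_i \sum_j `|invmx E i j|.
have M0 : 0 <= M by apply: sumr_ge0 => i _; apply: sumr_ge0.
exists (eta / (1 + M)) => [|w wd]; first by apply: divr_gt0 => //; lra.
have le k : `|(w *m invmx E) 0 k| <= eta.
  rewrite mxE (le_trans (ler_norm_sum _ _ _))//.
  apply: (@le_trans _ _ (\sum_i (eta / (1 + M)) * `|invmx E i k|)).
    by apply: ler_sum => i _; rewrite normrM ler_wpM2r // ltW.
  rewrite -mulr_sumr mulrAC ler_pdivrMr; last lra.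
  rewrite ler_wpM2l ?(ltW eta0) //.
  apply: (@le_trans _ _ M); last lra.
  apply: ler_sum => i _; rewrite (bigD1 k) //= lerDl.
  exact: sumr_ge0.
exists ((w *m invmx E) 0 0), ((w *m invmx E) 0 1), ((w *m invmx E) 0 2%:R).
by split; rewrite // -comb mulmxKV.
Qed.

(** The points [p], [q], [r] and [y] span a tetrahedron that contains the
    midpoint in its interior.  The apex [y] lies only in the closure of [C], so
    it is replaced by a nearby point [y'] of [C]: every point [z] near the
    midpoint is still a convex combination of [p], [q], [r] and [y'] with
    positive coefficients. *)
Lemma convex_interior_midpoint C n p q r y (c : R) : @convex_set R E3 C ->
  C p -> C q -> C r -> aff_indep p q r ->
  dot n p = c -> dot n q = c -> dot n r = c ->
  closure C y -> dot n y <> c ->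
  interior C (2^-1 *: (3^-1 *: (p + q + r)) + 2^-1 *: y).
Proof.
move=> cC Cp Cq Cr ind np nq nr Cy ny.
have [x xE] : exists x, x = 3^-1 *: (p + q + r) by exists (3^-1 *: (p + q + r)).
rewrite -xE; set m := _ + _.
have nx : dot n x = c by rewrite xE dotZr !dotDr np nq nr; field.
have ind3 a b g : a *: (q - p) + b *: (r - p) + g *: (y - x) = 0 ->
    [/\ a = 0, b = 0 & g = 0].
  move=> e; have g0 : g = 0.
    move/(congr1 (dot n)): e; rewrite !(dotDr, dotZr, dotNr) np nq nr nx.
    have -> : dot n 0 = 0 by rewrite /dot trmx0 mulmx0 mxE.
    rewrite !subrr !mulr0 !add0r => /eqP; rewrite mulf_eq0 => /orP[/eqP//|].
    by rewrite subr_eq0 => /eqP.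
  by move: e; rewrite g0 scale0r addr0 => /ind[].
have eta0 : (0 : R) < 32^-1 by lra.
have [delta delta0 small] := small_coordinates eta0 ind3.
have near_small u v : ball u delta v -> forall j, `|(v - u) 0 j| < delta.
  by move=> [_ uv] j; have := uv 0 j; rewrite !mxE distrC.
have [y' [Cy' /near_small/small]] := Cy _ (nbhsx_ballx _ _ delta0).
move=> [a [b [g [y'y [ae be ge]]]]].
apply/nbhs_ballP; exists delta => //= z /near_small/small[a2 [b2 [g2 [zm [a2e b2e g2e]]]]].
move: ae be ge a2e b2e g2e; rewrite !ler_norml => /andP[? ?] /andP[? ?] /andP[? ?]
  /andP[? ?] /andP[? ?] /andP[? ?].
(* [s] is the weight of [y'] in [z], found by comparing the components along
   [y - x]; the bound [32^-1] keeps the weights of [p], [q], [r] positive. *)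
pose s := (2^-1 + g2) / (1 + g).
have s_def : s * (1 + g) = 2^-1 + g2 by rewrite /s divfK //; lra.
have s_le : s <= 5 / 9 by rewrite ler_pdivrMr; lra.
have s_ge : 4 / 9 <= s by rewrite ler_pdivlMr; lra.
have sa : `|s * a| <= 32^-1.
  by rewrite normrM (@le_trans _ _ (1 * 32^-1)) ?ler_pM // ?ler_norml; lra.
have sb : `|s * b| <= 32^-1.
  by rewrite normrM (@le_trans _ _ (1 * 32^-1)) ?ler_pM // ?ler_norml; lra.
move: sa sb; rewrite !ler_norml => /andP[? ?] /andP[? ?].
pose a' := a2 - s * a; pose b' := b2 - s * b.
have -> : z = ((1 - s) / 3 - a' - b') *: p + ((1 - s) / 3 + a') *: q
              + ((1 - s) / 3 + b') *: r + s *: y'.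
  move/rowP: zm => zm; move/rowP: y'y => y'y; apply/rowP => j.
  move: (zm j) (y'y j); rewrite !mxE => /eqP; rewrite subr_eq => /eqP -> /eqP.
  rewrite subr_eq => /eqP ->.
  have -> : g2 = s * (1 + g) - 2^-1 by lra.
  rewrite xE !mxE.
  by rewrite /a' /b'; field.
by apply: convex_comb4 => //; rewrite /a' /b'; lra.
Qed.

(** * Orthogonally connected boundaries *)

Lemma not_interior_supported K n (c : R) x : (forall y, K y -> dot n y <= c) ->
  n != 0 -> dot n x = c -> ~ interior K x.
Proof.
move=> Kc n0 nx /nbhs_ballP[e /= e0 eK].
have nn : 0 < dot n n.
  rewrite lt_neqAle eq_sym /dot mxE sumr_ge0 ?andbT; last first.
    by move=> i _; rewrite mxE -expr2 sqr_ge0.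
  apply: contra n0; rewrite psumr_eq0 => [/allP z|i _]; last by rewrite mxE -expr2 sqr_ge0.
  apply/eqP/rowP => i; have := z i (mem_index_enum _).
  by rewrite !mxE mulf_eq0 orbb => /eqP.
pose N := 1 + \sum_j `|n 0 j|.
have N0 : 0 < N by rewrite ltr_wpDr // sumr_ge0.
pose t := e / N.
have t0 : 0 < t by rewrite divr_gt0.
have : K (x + t *: n).
  apply: eK; split => // i j; rewrite (ord1 i) /ball /= !mxE opprD addNKr normrN.
  rewrite normrM (gtr0_norm t0) mulrAC ltr_pdivrMr // ltr_pM2l //.
  rewrite /N (bigD1 j) //= addrCA ltrDl ltr_wpDr // sumr_ge0 //.
by move=> /Kc; rewrite dotDr dotZr nx gerDl leNgt mulr_gt0.
Qed.

Lemma axis_parallel_normal n x y :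
  axis_parallel x y -> x <> y -> dot n y = dot n x -> exists i, n 0 i = 0.
Proof.
move=> [i par] xy nxy; exists i.
have: dot n (y - x) = 0 by rewrite dotDr dotNr nxy subrr.
have yxE : y - x = (y 0 i - x 0 i) *: delta_mx 0 i.
  apply/rowP => j; rewrite !mxE eqxx /=.
  by case: eqVneq => [->|/par->]; rewrite ?mulr1 ?subrr ?mulr0.
rewrite yxE dotZr.
have -> : dot n (delta_mx 0 i) = n 0 i.
  by rewrite /dot trmx_delta -colE mxE.
move/eqP; rewrite mulf_eq0 => /orP[|/eqP//].
rewrite subr_eq0 => /eqP yx; case: xy; apply/rowP => j.
by have [->|/par] := eqVneq j i.
Qed.

Lemma path_leaves (m : nat) (P : nat -> E3) : P 0%N <> P m ->
  exists2 k, (k < m)%N & P k = P 0%N /\ P k.+1 <> P 0%N.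
Proof.
elim: m => // m IH nP.
have [e|ne] := pselect (P m = P 0%N).
  by exists m => //; split=> // e'; apply: nP.
have [k km kP] := IH (fun e => ne (esym e)).
by exists k => //; apply: ltnW.
Qed.

(** Consider the centroid [x] of a triangle in the facet, and the first edge by
    which an orthogonal path leaves [x].  If that edge, ending in [y], left the
    plane of the facet, then its midpoint would be interior to [C] although the
    edge lies in the boundary.  So the edge lies in that plane, and its
    direction, a coordinate axis, is perpendicular to [n]. *)
Theorem connected_facet_normal C n : @convex_set R E3 C ->
  orthogonally_connected (boundary C) -> facet_normal C n ->
  exists i, n 0 i = 0.
Proof.
move=> cC conn [c [p [q [r [Cc [Cp Cq Cr] [np nq nr] ind]]]]].
have [->|n0] := eqVneq n 0; first by exists 0; rewrite mxE.
pose x := 3^-1 *: (p + q + r).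
have nx : dot n x = c by rewrite dotZr !dotDr np nq nr; field.
have Cx : C x.
  have -> : x = 3^-1 *: p + 3^-1 *: q + 3^-1 *: r by rewrite -!scalerDr.
  by apply: convex_comb3 => //; lra.
have bd z : C z -> dot n z = c -> boundary C z.
  by move=> Cz nz; split; [exact: subset_closure | exact: not_interior_supported nz].
have xp : x <> p.
  move=> xp; have [] := ind 1 1; last by move/eqP; rewrite oner_eq0.
  have -> : 1 *: (q - p) + 1 *: (r - p) = 3 *: (x - p).
    by apply/rowP => j; rewrite !mxE; field.
  by rewrite xp subrr scaler0.
have [m [P [P0 Pm path]]] := conn x p (bd _ Cx nx) (bd _ Cp np) xp.
have [|k km [Pk Pk1]] := @path_leaves m P; first by rewrite P0 Pm.
have {path}[par seg] := path k km.
set y := P k.+1 in par seg Pk1; rewrite Pk P0 in par seg Pk1.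
have Cy : closure C y.
  apply: (proj1 (seg y _)); exists 1; rewrite /= ?in_itv /= ?lexx ?ler01 //.
  by rewrite subrr scale0r add0r scale1r.
apply: (axis_parallel_normal par) => [/esym//|].
rewrite nx; apply: contrapT => ny.
have int : interior C (2^-1 *: x + 2^-1 *: y).
  exact: (convex_interior_midpoint cC Cp Cq Cr ind np nq nr Cy ny).
have : boundary C (2^-1 *: x + 2^-1 *: y).
  apply: seg; exists 2^-1; first by rewrite /= in_itv /=; lra.
  by congr (_ *: _ + _); lra.
by case.
Qed.

(** No line meets a parabola in three points. *)
Lemma aff_indep_parabola p q r (s t u : R) : aff_indep p q r ->
  s != t -> t != u -> u != s ->
  let f a := p + a *: (q - p) + a ^+ 2 *: (r - p) in
  aff_indep (f s) (f t) (f u).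
Proof.
move=> ind st tu us f a b e.
have [] := ind (a * (t - s) + b * (u - s)) (a * (t ^+ 2 - s ^+ 2) + b * (u ^+ 2 - s ^+ 2)).
  rewrite -[RHS]e; apply/rowP => j; rewrite !mxE; ring.
move=> e1 e2.
have b0 : b = 0.
  have: b * ((u - s) * (u - t)) = 0.
    transitivity (a * (t ^+ 2 - s ^+ 2) + b * (u ^+ 2 - s ^+ 2) -
                  (t + s) * (a * (t - s) + b * (u - s))); first by ring.
    by rewrite e1 e2 mulr0 subrr.
  by move/eqP; rewrite !mulf_eq0 !subr_eq0 (negPf us) [u == t]eq_sym (negPf tu) !orbF => /eqP.
split=> //; move/eqP: e1; rewrite b0 mul0r addr0 mulf_eq0 subr_eq0.
by rewrite [t == s]eq_sym (negPf st) orbF => /eqP.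
Qed.

(** A triangle is not covered by finitely many segments, so one of the pieces
    that cover a facet has three non-collinear points in it.  A pigeonhole
    argument on points of a parabola inscribed in the triangle finds them. *)
Lemma facet_normal_cover K n k (Q : 'I_k -> set E3) : @convex_set R E3 K ->
  K = \bigcup_i Q i -> facet_normal K n -> exists i, facet_normal (Q i) n.
Proof.
move=> cK KQ [c [p [q [r [Kc [Kp Kq Kr] [np nq nr] ind]]]]].
pose f (a : R) := p + a *: (q - p) + a ^+ 2 *: (r - p).
(* For parameters between 0 and 1/2 the parabola stays inside the triangle. *)
pose t (j : 'I_(k * 2).+1) : R := (j.+2%:R)^-1.
have Kf j : K (f (t j)).
  have tle : 0 < t j <= 2^-1 by rewrite /t invr_gt0 ltr0n /= lef_pV2 ?posrE ?ltr0n // ler_nat.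
  have -> : f (t j) = (1 - t j - t j ^+ 2) *: p + t j *: q + t j ^+ 2 *: r.
    by apply/rowP => l; rewrite !mxE; ring.
  apply: convex_comb3 => //; rewrite ?sqr_ge0 //; nra.
have nf a : dot n (f a) = c.
  by rewrite /f !(dotDr, dotZr, dotNr) np nq nr !subrr !mulr0 !addr0.
have tinj : injective t.
  by move=> i j /invr_inj/eqP; rewrite eqr_nat => /eqP[] /val_inj.
have /choice[g gP] : forall j, exists i, Q i (f (t j)).
  by move=> j; have := Kf j; rewrite {1}KQ => -[i _ Qi]; exists i.
have [i /card_gt2P[j1 [j2 [j3 [[]]]]]] : exists i, (2 < #|[pred j | g j == i]|)%N.
  apply: contrapT => /forallNP noti.
  have : (\sum_i #|[pred j | g j == i]| <= k * 2)%N.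
    rewrite -[X in (_ <= X * _)%N]card_ord -sum_nat_const; apply: leq_sum => i _.
    by rewrite leqNgt; apply/negP/noti.
  suff -> : (\sum_i #|[pred j | g j == i]| = (k * 2).+1)%N by rewrite ltnn.
  rewrite -[RHS]card_ord -sum1_card (partition_big g xpredT) //=.
  by apply: eq_bigr => i _; rewrite sum1_card.
rewrite !inE => /eqP g1 /eqP g2 /eqP g3 [n12 n23 n31].
exists i, c, (f (t j1)), (f (t j2)), (f (t j3)); split.
- by move=> x Qx; apply: Kc; rewrite KQ; exists i.
- by split; [rewrite -g1|rewrite -g2|rewrite -g3].
- by rewrite !nf.
- by apply: aff_indep_parabola => //; rewrite (inj_eq tinj).
Qed.

(** * Necessary condition for decomposability *)

Lemma convex_hull_convex V : @convex_set R E3 (convex_hull V).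
Proof.
move=> x y t; rewrite !inE => Vx Vy C [cC VC].
by have := cC x y t; rewrite !inE; apply; [apply: Vx | apply: Vy].
Qed.

Lemma sub_convex_hull V : V `<=` convex_hull V.
Proof. by move=> v Vv C [_]; apply. Qed.

Lemma facet_normal_hull V n : facet_normal V n -> facet_normal (convex_hull V) n.
Proof.
move=> [c [p [q [r [Vc [Vp Vq Vr] eqs ind]]]]].
exists c, p, q, r; split=> //; last by split; apply: sub_convex_hull.
move=> x /(_ [set y | dot n y <= c]); apply; split=> // y z t; rewrite !inE /= => yc zc.
rewrite dotDr !dotZr.
have t0 : 0 <= t%:num by [].
have t1 : t%:num <= 1 by [].
by rewrite /unstable.onem; nra.
Qed.

Lemma dot_mulmx n x (B : 'M[R]_3) :
  B *m B^T = 1%:M -> dot (n *m B) (x *m B) = dot n x.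
Proof. by move=> BB; rewrite /dot trmx_mul mulmxA -(mulmxA n) BB mulmx1. Qed.

Lemma facet_normal_image K n (c : R) (B : 'M[R]_3) (b : E3) :
  0 < c -> B *m B^T = 1%:M -> facet_normal K n ->
  facet_normal [set c *: (x *m B) + b | x in K] (n *m B).
Proof.
move=> c0 BB [d [p [q [r [Kd [Kp Kq Kr] [np nq nr] ind]]]]].
pose f x := c *: (x *m B) + b.
have nf x : dot (n *m B) (f x) = c * dot n x + dot (n *m B) b.
  by rewrite dotDr dotZr dot_mulmx.
exists (c * d + dot (n *m B) b), (f p), (f q), (f r); split.
- by move=> _ [x Kx <-]; rewrite nf lerD2r ler_pM2l //; apply: Kd.
- by split; [exists p | exists q | exists r].
- by rewrite !nf np nq nr.
- move=> s t e; apply: ind.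
  have : c *: ((s *: (q - p) + t *: (r - p)) *m B) = 0.
    rewrite -[RHS]e /f mulmxDl -!scalemxAl !mulmxBl.
    by apply/rowP => j; rewrite !mxE; ring.
  move/(congr1 (fun w => c^-1 *: w *m B^T)).
  rewrite scalerA mulVf ?gt_eqF // scale1r -mulmxA BB mulmx1 => ->.
  by rewrite scaler0 mul0mx.
Qed.

Lemma convex_image K (c : R) (B : 'M[R]_3) (b : E3) : @convex_set R E3 K ->
  @convex_set R E3 [set c *: (x *m B) + b | x in K].
Proof.
move=> cK y z t; rewrite !inE => -[x Kx <-] [x' Kx' <-].
exists (t%:num *: x + (1 - t%:num) *: x').
  by have := cK x x' t; rewrite !inE; apply.
rewrite /conv /= /unstable.onem mulmxDl -!scalemxAl.
by apply/rowP => j; rewrite !mxE; ring.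
Qed.

(** The columns of [B] are the directions, pulled back to the space of [V], of
    the axes used by the orthogonal paths. *)
Theorem decomposable_frame V P : Defs.similar (convex_hull V) P ->
  orthogonally_decomposable P ->
  exists2 B : 'M[R]_3, B *m B^T = 1%:M &
    forall n, facet_normal V n -> exists i, (n *m B) 0 i = 0.
Proof.
move=> [c [A [b [c0 AA ->]]]] [A' [[AA' _] [k [Q [[polyQ PQ _] conn]]]]].
have cQ i : @convex_set R E3 (Q i).
  by have [W _ ->] := polyQ i; exact: convex_hull_convex.
have BB : (A *m A') *m (A *m A')^T = 1%:M.
  by rewrite trmx_mul mulmxA -(mulmxA A) AA' mulmx1.
exists (A *m A') => // n nV.
have PE : [set x *m A' | x in [set c *: (x *m A) + b | x in convex_hull V]] =
    [set c *: (x *m (A *m A')) + b *m A' | x in convex_hull V].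
  rewrite image_comp; congr image; apply/funext => x /=.
  by rewrite mulmxDl -scalemxAl mulmxA.
rewrite PE in PQ.
have [||i fi] := @facet_normal_cover _ (n *m (A *m A')) _ Q _ PQ.
- exact/convex_image/convex_hull_convex.
- exact/facet_normal_image/facet_normal_hull.
exact: connected_facet_normal (cQ i) (conn i) fi.
Qed.

Lemma pt_mulmx (x y z : R) (B : 'M[R]_3) i :
  (pt x y z *m B) 0 i = x * B 0 i + y * B 1 i + z * B 2%:R i.
Proof.
rewrite mxE !big_ord_recl big_ord0 !mxE /= addr0 addrA.
by congr (_ * B _ _ + _ * B _ _ + _ * B _ _); apply/val_inj.
Qed.

End Facets.

(** The cubic form [f] that multiplies the scalar products with the three
    columns of [B] vanishes on [N] if every member of [N] is perpendicular to a
    column.  On the four diagonals [pt (+-1) (+-1) (+-1)], the parity in each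
    variable gives four linear relations between its coefficients; the
    orthogonality of the columns then kills the coefficients of the cubes, and
    there remains
    f = c1 x (y^2 - z^2) + c2 y (z^2 - x^2) + c3 z (x^2 - y^2).
    Parity again, at the sign changes of [pt p q r] and of its cyclic images,
    makes [c1], [c2] and [c3] vanish.  But [f] takes the value 1 at the sum of
    the columns. *)
Lemma no_frame (R : realType) (N : set 'rV[R]_3) (B : 'M[R]_3) (p q r : R) :
  B *m B^T = 1%:M ->
  (forall x y z, N (pt x y z) -> N (pt y z x)) ->
  (forall x y z, N (pt x y z) -> N (pt x (- y) (- z))) ->
  N (pt 1 1 1) -> N (pt p q r) -> p * (q ^+ 2 - r ^+ 2) != 0 ->
  exists2 n, N n & forall i, (n *m B) 0 i != 0.
Proof.
move=> BB cyc flip N1 Npqr nz.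
apply: contrapT => noN.
have {noN} zero x y z : N (pt x y z) ->
    \prod_i (x * B 0 i + y * B 1 i + z * B 2%:R i) = 0.
  move=> Nn; apply/eqP/prodf_eq0; apply: contrapT => nex; case: noN.
  exists (pt x y z) => // i; rewrite pt_mulmx; apply/eqP => e; case: nex.
  by exists i; rewrite ?e.
have orth i j : B 0 i * B 0 j + B 1 i * B 1 j + B 2%:R i * B 2%:R j = (i == j)%:R.
  have /matrixP/(_ i j) := mulmx1C BB.
  rewrite !mxE !big_ord_recl big_ord0 !mxE addr0 addrA => <-.
  by congr (B _ _ * B _ _ + B _ _ * B _ _ + B _ _ * B _ _); apply/val_inj.
have prodE (F : 'I_3 -> R) : \prod_i F i = F 0 * F 1 * F 2%:R.
  rewrite !big_ord_recl big_ord0 mulr1 mulrA.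
  by congr (F _ * F _ * F _); apply/val_inj.
move: (orth 0 0) (orth 1 1) (orth 2%:R 2%:R) (orth 0 1) (orth 0 2%:R) (orth 1 2%:R).
rewrite !eqxx /=.
pose f x y z := (x * B 0 0 + y * B 1 0 + z * B 2%:R 0) *
  (x * B 0 1 + y * B 1 1 + z * B 2%:R 1) *
  (x * B 0 2%:R + y * B 1 2%:R + z * B 2%:R 2%:R).
have {}zero x y z : N (pt x y z) -> f x y z = 0.
  by move=> /zero; rewrite prodE.
have flipy x y z : N (pt x y z) -> N (pt (- x) y (- z)).
  by move=> /cyc/flip/cyc/cyc.
have flipz x y z : N (pt x y z) -> N (pt (- x) (- y) z).
  by move=> /cyc/cyc/flip/cyc.
move: {orth prodE} zero; rewrite /f {f}.
move: (B 0 0) (B 1 0) (B 2%:R 0) (B 0 1) (B 1 1) (B 2%:R 1) (B 0 2%:R) (B 1 2%:R) (B 2%:R 2%:R).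
move=> a1 b1 c1 a2 b2 c2 a3 b3 c3.
pose f x y z := (x * a1 + y * b1 + z * c1) * (x * a2 + y * b2 + z * c2) *
  (x * a3 + y * b3 + z * c3).
move=> zero_ o11 o22 o33 o12 o13 o23.
have {zero_} zero x y z : N (pt x y z) -> f x y z = 0 := zero_ x y z.
(* [cxy] is the coefficient of [x * y ^+ 2], and so on. *)
pose cx := a1 * a2 * a3; pose cy := b1 * b2 * b3; pose cz := c1 * c2 * c3.
pose cxy := a1 * b2 * b3 + b1 * a2 * b3 + b1 * b2 * a3.
pose cxz := a1 * c2 * c3 + c1 * a2 * c3 + c1 * c2 * a3.
pose cyx := b1 * a2 * a3 + a1 * b2 * a3 + a1 * a2 * b3.
pose cyz := b1 * c2 * c3 + c1 * b2 * c3 + c1 * c2 * b3.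
pose czx := c1 * a2 * a3 + a1 * c2 * a3 + a1 * a2 * c3.
pose czy := c1 * b2 * b3 + b1 * c2 * b3 + b1 * b2 * c3.
pose cxyz := a1 * b2 * c3 + a1 * c2 * b3 + b1 * a2 * c3 + b1 * c2 * a3
  + c1 * a2 * b3 + c1 * b2 * a3.
have fE x y z : f x y z = cx * x ^+ 3 + cxy * (x * y ^+ 2) + cxz * (x * z ^+ 2)
   + cy * y ^+ 3 + cyx * (y * x ^+ 2) + cyz * (y * z ^+ 2)
   + cz * z ^+ 3 + czx * (z * x ^+ 2) + czy * (z * y ^+ 2) + cxyz * (x * y * z).
  by rewrite /f /cx /cy /cz /cxy /cxz /cyx /cyz /czx /czy /cxyz; ring.
(* In [cxy + cxz], each of the three scalar products of two columns occurs
   without one of its terms, and thus contributes [- cx]. *)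
have tx : cx + cxy + cxz = - 2 * cx.
  transitivity (cx + a1 * (b2 * b3 + c2 * c3) + a2 * (b1 * b3 + c1 * c3)
     + a3 * (b1 * b2 + c1 * c2)); first by rewrite /cxy /cxz; ring.
  rewrite (_ : b2 * b3 + c2 * c3 = - (a2 * a3)); last lra.
  rewrite (_ : b1 * b3 + c1 * c3 = - (a1 * a3)); last lra.
  rewrite (_ : b1 * b2 + c1 * c2 = - (a1 * a2)); last lra.
  by rewrite /cx; ring.
have ty : cy + cyx + cyz = - 2 * cy.
  transitivity (cy + b1 * (a2 * a3 + c2 * c3) + b2 * (a1 * a3 + c1 * c3)
     + b3 * (a1 * a2 + c1 * c2)); first by rewrite /cyx /cyz; ring.
  rewrite (_ : a2 * a3 + c2 * c3 = - (b2 * b3)); last lra.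
  rewrite (_ : a1 * a3 + c1 * c3 = - (b1 * b3)); last lra.
  rewrite (_ : a1 * a2 + c1 * c2 = - (b1 * b2)); last lra.
  by rewrite /cy; ring.
have tz : cz + czx + czy = - 2 * cz.
  transitivity (cz + c1 * (a2 * a3 + b2 * b3) + c2 * (a1 * a3 + b1 * b3)
     + c3 * (a1 * a2 + b1 * b2)); first by rewrite /czx /czy; ring.
  rewrite (_ : a2 * a3 + b2 * b3 = - (c2 * c3)); last lra.
  rewrite (_ : a1 * a3 + b1 * b3 = - (c1 * c3)); last lra.
  rewrite (_ : a1 * a2 + b1 * b2 = - (c1 * c2)); last lra.
  by rewrite /cz; ring.
have f1 : f (a1 + a2 + a3) (b1 + b2 + b3) (c1 + c2 + c3) = 1.
  rewrite /f.
  rewrite (_ : _ * a1 + _ * b1 + _ * c1 = 1); last lra.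
  rewrite (_ : _ * a2 + _ * b2 + _ * c2 = 1); last lra.
  rewrite (_ : _ * a3 + _ * b3 + _ * c3 = 1); last lra.
  by rewrite !mulr1.
(* The part of [f] that is odd in [x] and even in [y] and [z], and so on. *)
have wx x y z : N (pt x y z) -> cx * x ^+ 3 + cxy * (x * y ^+ 2) + cxz * (x * z ^+ 2) = 0.
  move=> Nn; move: (zero _ _ _ Nn) (zero _ _ _ (flip _ _ _ Nn)).
  move: (zero _ _ _ (flipy _ _ _ Nn)) (zero _ _ _ (flipz _ _ _ Nn)).
  by rewrite !fE; lra.
have wy x y z : N (pt x y z) -> cy * y ^+ 3 + cyx * (y * x ^+ 2) + cyz * (y * z ^+ 2) = 0.
  move=> Nn; move: (zero _ _ _ Nn) (zero _ _ _ (flip _ _ _ Nn)).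
  move: (zero _ _ _ (flipy _ _ _ Nn)) (zero _ _ _ (flipz _ _ _ Nn)).
  by rewrite !fE; lra.
have wz x y z : N (pt x y z) -> cz * z ^+ 3 + czx * (z * x ^+ 2) + czy * (z * y ^+ 2) = 0.
  move=> Nn; move: (zero _ _ _ Nn) (zero _ _ _ (flip _ _ _ Nn)).
  move: (zero _ _ _ (flipy _ _ _ Nn)) (zero _ _ _ (flipz _ _ _ Nn)).
  by rewrite !fE; lra.
have nz' : p * q ^+ 2 - p * r ^+ 2 != 0 by rewrite -mulrBr.
have kill d e g : d = 0 -> d + e + g = 0 ->
    d * p ^+ 3 + e * (p * q ^+ 2) + g * (p * r ^+ 2) = 0 -> e = 0 /\ g = 0.
  move=> -> eg; rewrite (_ : g = - e); last lra.
  rewrite mul0r add0r mulNr -mulrBr => /eqP; rewrite mulf_eq0 (negPf nz') orbF.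
  by move=> /eqP ->; rewrite oppr0.
have sx := wx _ _ _ N1; have sy := wy _ _ _ N1; have sz := wz _ _ _ N1.
rewrite !expr1n !mulr1 in sx sy sz.
have cx0 : cx = 0 by lra.
have cy0 : cy = 0 by lra.
have cz0 : cz = 0 by lra.
have [cxy0 cxz0] := kill _ _ _ cx0 sx (wx _ _ _ Npqr).
(* The cyclic image whose second entry is [p] puts the pair [q], [r] on the
   coefficients [cyz], [cyx]. *)
have [cyz0 cyx0] : cyz = 0 /\ cyx = 0.
  by apply: (kill cy) => //; [lra | have := wy _ _ _ (cyc _ _ _ (cyc _ _ _ Npqr)); lra].
have [czx0 czy0] := kill _ _ _ cz0 sz (wz _ _ _ (cyc _ _ _ Npqr)).
have cxyz0 : cxyz = 0.
  by have := zero _ _ _ N1; rewrite fE; lra.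
move: f1; rewrite fE cx0 cy0 cz0 cxy0 cxz0 cyx0 cyz0 czx0 czy0 cxyz0 !mul0r !addr0.
by move/esym/eqP; rewrite oner_eq0.
Qed.

(** * Orbits of signed permutations *)

Section Orbits.
Variable R : realType.
Local Notation E3 := 'rV[R]_3.
Implicit Types (s t : 'S_3) (d e : {ffun 'I_3 -> bool}) (V : set E3).
Implicit Types (G : 'S_3 -> {ffun 'I_3 -> bool} -> bool) (us : seq E3).

Lemma signed_permM s d t e (u : E3) : signed_perm s d (signed_perm t e u) =
  signed_perm (s * t)%g [ffun i => d i (+) e (s i)] u.
Proof. by apply/rowP => i; rewrite !mxE ffunE permM mulrA signr_addb. Qed.

Lemma signed_permK s e : cancel (@signed_perm R s e)
  (signed_perm s^-1%g [ffun i => e ((s^-1)%g i)]).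
Proof.
by move=> u; apply/rowP => i; rewrite !mxE ffunE mulrA -signr_addb addbb mul1r permKV.
Qed.

Lemma dot_signed_perm s e (u v : E3) : dot (signed_perm s e u) v =
  dot u (signed_perm s^-1%g [ffun i => e ((s^-1)%g i)] v).
Proof.
rewrite /dot !mxE (reindex_inj (@perm_inj _ (s^-1)%g)) /=; apply: eq_bigr => i _.
by rewrite !mxE ffunE permKV mulrCA mulrA.
Qed.

Lemma odd_signs_twist s d e :
  odd_signs [ffun i => d i (+) e (s i)] = odd_signs d (+) odd_signs e.
Proof.
rewrite /odd_signs [X in _ (+) X](reindex_inj (@perm_inj _ s)) /= -big_split /=.
by apply: eq_bigr => i _; rewrite ffunE.
Qed.

Lemma tetrahedral_rot_inv s e : tetrahedral_rot s e ->
  tetrahedral_rot s^-1%g [ffun i => e ((s^-1)%g i)].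
Proof.
rewrite /tetrahedral_rot odd_permV => /andP[-> /=]; congr (~~ _).
rewrite /odd_signs (reindex_inj (@perm_inj _ (s^-1)%g)) /=.
by apply: eq_bigr => i _; rewrite ffunE.
Qed.

Definition tetra_stable G := forall s e t d, tetrahedral_rot s e -> G t d ->
  G (s * t)%g [ffun i => e i (+) d (s i)].

Lemma tetra_stable_all : tetra_stable all_signed.
Proof. by []. Qed.

Lemma tetra_stable_even : tetra_stable even_signed.
Proof.
by move=> s e t d /andP[/negPf se _] /negPf td; rewrite /even_signed odd_permM se td.
Qed.

Lemma tetra_stable_octahedral : tetra_stable octahedral_rot.
Proof.
move=> s e t d /andP[/negPf se /negPf ee] /eqP td.
by rewrite /octahedral_rot odd_permM odd_signs_twist se ee td.
Qed.

Lemma tetra_stable_tetrahedral : tetra_stable tetrahedral_rot.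
Proof.
move=> s e t d /andP[/negPf se /negPf ee] /andP[/negPf td /negPf dd].
by rewrite /tetrahedral_rot odd_permM odd_signs_twist se ee td dd.
Qed.

Definition tetra_invariant V := forall s e v,
  tetrahedral_rot s e -> V v -> V (signed_perm s e v).

Lemma orbits_tetra_invariant G us : tetra_stable G -> tetra_invariant (orbits G us).
Proof.
move=> stG s e _ se [u [t [d [uus Gtd ->]]]].
exists u, (s * t)%g, [ffun i => e i (+) d (s i)]; split=> //; first exact: stG.
by rewrite signed_permM.
Qed.

Lemma facet_normal_tetra V n s e : tetra_invariant V -> tetrahedral_rot s e ->
  facet_normal V n -> facet_normal V (signed_perm s e n).
Proof.
move=> Vinv se [c [p [q [r [Vc [Vp Vq Vr] [np nq nr] ind]]]]].
exists c, (signed_perm s e p), (signed_perm s e q), (signed_perm s e r); split.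
- by move=> x Vx; rewrite dot_signed_perm; apply/Vc/Vinv => //; exact: tetrahedral_rot_inv.
- by split; apply: Vinv.
- by rewrite !dot_signed_perm !signed_permK.
move=> a b ab; apply: ind; apply/rowP => i.
move/rowP: ab => /(_ (s^-1%g i)); rewrite !mxE permKV => ab.
move/(congr1 (fun y => (-1) ^+ e (s^-1%g i) * y)): ab; rewrite mulr0 => <-.
by case: (e _); rewrite ?expr0 ?expr1; ring.
Qed.

Lemma tetra_cycle V (x y z : R) : tetra_invariant V ->
  V (pt x y z) -> V (pt y z x).
Proof.
pose c : 'S_3 := (tperm 0%R 1%R * tperm 0%R 2%:R)%g; move=> inv /(inv c [ffun=> false]).
have -> : signed_perm c [ffun=> false] (pt x y z) = pt y z x.
  apply/rowP => i; rewrite !mxE ffunE expr0 mul1r permM.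
  by case: (ord3P i) => ->; rewrite !permE.
apply; apply/andP; split; first by rewrite odd_permM !odd_tperm.
by rewrite /odd_signs big1 // => i _; rewrite ffunE.
Qed.

Lemma tetra_flip V (x y z : R) : tetra_invariant V ->
  V (pt x y z) -> V (pt x (- y) (- z)).
Proof.
pose e : {ffun 'I_3 -> bool} := [ffun i => i != 0]; pose o : 'S_3 := 1%g; move=> inv /(inv o e).
have -> : signed_perm o e (pt x y z) = pt x (- y) (- z).
  apply/rowP => i; rewrite !mxE ffunE perm1.
  by case: (ord3P i) => -> /=; rewrite ?mul1r ?mulN1r.
apply; apply/andP; split; first by rewrite odd_perm1.
by rewrite /odd_signs !big_ord_recl big_ord0 !ffunE.
Qed.

(** A frame allowed by the four diagonals consists of a coordinate vector and
    the two diagonals of the plane perpendicular to it.  The condition on [p],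
    [q], [r] says that [pt p q r] is not perpendicular to any vector of such a
    frame if the coordinate vector is the first one; the cyclic images of
    [pt p q r] exclude the other two frames. *)
Theorem tetrahedral_not_decomposable V P (p q r : R) : tetra_invariant V ->
  facet_normal V (pt 1 1 1) -> facet_normal V (pt p q r) ->
  p * (q ^+ 2 - r ^+ 2) != 0 ->
  Defs.similar (convex_hull V) P -> ~ orthogonally_decomposable P.
Proof.
move=> Vinv f1 fpqr nz simP decP.
have inv : tetra_invariant (facet_normal V).
  by move=> s e v se; apply: facet_normal_tetra.
have [B BB zero] := decomposable_frame simP decP.
have [n /zero[i ni] /(_ i)] := no_frame BB (fun x y z => @tetra_cycle _ x y z inv)
  (fun x y z => @tetra_flip _ x y z inv) f1 fpqr nz.
by rewrite ni eqxx.
Qed.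

(** * Finding facets *)

Lemma aff_indep_minor (p q r : E3) i j :
  (q - p) 0 i * (r - p) 0 j - (q - p) 0 j * (r - p) 0 i != 0 -> aff_indep p q r.
Proof.
set m := _ - _ => m0 a b /rowP e.
have : a * m = 0 /\ b * m = 0.
  have entry k : a * (q - p) 0 k + b * (r - p) 0 k = 0.
    by have := e k; rewrite !mxE.
  move: (entry i) (entry j) => ei ej.
  split; [transitivity ((r - p) 0 j * 0 - (r - p) 0 i * 0); last by ring|
          transitivity ((q - p) 0 i * 0 - (q - p) 0 j * 0); last by ring].
  - by rewrite -{1}ei -ej /m; ring.
  - by rewrite -{1}ej -ei /m; ring.
by move=> [/eqP + /eqP]; rewrite !mulf_eq0 (negPf m0) !orbF => /eqP -> /eqP ->.
Qed.

Lemma dot_pt (a b c x y z : R) : dot (pt a b c) (pt x y z) = a * x + b * y + c * z.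
Proof. by rewrite dotE !mxE. Qed.

(** The vertex [pt a b c] and its cyclic images form the triangle. *)
Lemma facet_normal_diagonal V (a b c : R) : tetra_invariant V ->
  (forall v, V v -> dot (pt 1 1 1) v <= a + b + c) ->
  V (pt a b c) -> a != b -> facet_normal V (pt 1 1 1).
Proof.
move=> inv Vle V1 ab; have V2 := tetra_cycle inv V1; have V3 := tetra_cycle inv V2.
exists (a + b + c), (pt a b c), (pt b c a), (pt c a b); split=> //.
  by rewrite !dot_pt !mul1r; split => //; ring.
apply: (@aff_indep_minor _ _ _ 0 1); rewrite !mxE /=.
rewrite (_ : _ - _ = - ((a - b) ^+ 2 + (b - c) ^+ 2 + (c - a) ^+ 2) / 2); last by field.
have : 0 < (a - b) ^+ 2 by rewrite exprn_even_gt0 //= subr_eq0.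
by have := sqr_ge0 (b - c); have := sqr_ge0 (c - a); lra.
Qed.

Lemma signed_permE s e (u : E3) : signed_perm s e u =
  pt ((-1) ^+ e 0 * u 0 (s 0)) ((-1) ^+ e 1 * u 0 (s 1)) ((-1) ^+ e 2%:R * u 0 (s 2%:R)).
Proof. by apply/rowP => i; rewrite !mxE; case: (ord3P i) => ->. Qed.

Lemma perm3P s :
  if odd_perm s then
    [\/ [/\ s 0 = 0, s 1 = 2%:R & s 2%:R = 1], [/\ s 0 = 1, s 1 = 0 & s 2%:R = 2%:R]
      | [/\ s 0 = 2%:R, s 1 = 1 & s 2%:R = 0]]
  else
    [\/ [/\ s 0 = 0, s 1 = 1 & s 2%:R = 2%:R], [/\ s 0 = 1, s 1 = 2%:R & s 2%:R = 0]
      | [/\ s 0 = 2%:R, s 1 = 0 & s 2%:R = 1]].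
Proof.
have sI i j : s i = s j -> i = j by exact: perm_inj.
have odd_of (t : 'S_3) b : odd_perm t = b -> s =1 t -> odd_perm s = b.
  by move=> tb /permP ->.
case: (ord3P (s 0)) (ord3P (s 1)) (ord3P (s 2%:R)) => s0 [] s1 [] s2;
  try (by have := sI 0 1; rewrite s0 s1 => /(_ erefl));
  try (by have := sI 0 2%:R; rewrite s0 s2 => /(_ erefl));
  try (by have := sI 1 2%:R; rewrite s1 s2 => /(_ erefl)).
- rewrite (@odd_of 1%g false) ?odd_perm1 //; first exact: Or31.
  by move=> i; rewrite perm1; case: (ord3P i) => ->.
- rewrite (@odd_of (tperm 1 2%:R) true) ?odd_tperm //; first exact: Or31.
  by move=> i; case: (ord3P i) => ->; rewrite ?tpermL ?tpermR ?tpermD.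
- rewrite (@odd_of (tperm 0 1) true) ?odd_tperm //; first exact: Or32.
  by move=> i; case: (ord3P i) => ->; rewrite ?tpermL ?tpermR ?tpermD.
- rewrite (@odd_of (tperm 0%R 1%R * tperm 0%R 2%:R)%g false) ?odd_permM ?odd_tperm //.
    exact: Or32.
  by move=> i; rewrite permM; case: (ord3P i) => ->; rewrite !permE.
- rewrite (@odd_of (tperm 0%R 2%:R * tperm 0%R 1%R)%g false) ?odd_permM ?odd_tperm //.
    exact: Or33.
  by move=> i; rewrite permM; case: (ord3P i) => ->; rewrite !permE.
- rewrite (@odd_of (tperm 0 2%:R) true) ?odd_tperm //; first exact: Or33.
  by move=> i; case: (ord3P i) => ->; rewrite ?tpermL ?tpermR ?tpermD.
Qed.

End Orbits.

(** * Solids with pyritohedral symmetry *)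

Section Pyritohedral.
Variable R : realType.
Local Notation E3 := 'rV[R]_3.
Implicit Types (us : seq E3).

Lemma mem_orbits (G : 'S_3 -> {ffun 'I_3 -> bool} -> bool) us (u : E3) :
  G (1%g : 'S_3) [ffun=> false] -> u \in us -> orbits G us u.
Proof.
move=> G1 uus; pose o : 'S_3 := 1%g; exists u, o, [ffun=> false]; split=> //.
by apply/rowP => i; rewrite !mxE ffunE perm1 expr0 mul1r.
Qed.

Lemma mem_orbits_even us (u : E3) : u \in us -> orbits even_signed us u.
Proof. by apply: mem_orbits; rewrite /even_signed odd_perm1. Qed.

Lemma orbits_even_reflect us (x y z : R) :
  orbits even_signed us (pt x y z) -> orbits even_signed us (pt (- x) y z).
Proof.
move=> [u [s [e [uus even xyz]]]]; pose o : 'S_3 := 1%g.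
exists u, s, [ffun i => (i == 0) (+) e i]; split=> //.
have -> : pt (- x) y z = signed_perm o [ffun i => i == 0] (pt x y z).
  by rewrite signed_permE /o !perm1 !ffunE !mxE /= !expr0 expr1 !mul1r mulN1r.
rewrite xyz signed_permM mul1g; congr signed_perm.
by apply/ffunP => i; rewrite !ffunE perm1.
Qed.

Lemma ler_sign_mul (b : bool) (k x : R) : 0 <= k -> 0 <= x ->
  k * ((-1) ^+ b * x) <= k * x.
Proof.
by move=> k0 x0; case: b; rewrite ?expr0 ?expr1 ?mul1r // mulN1r ler_wpM2l // ge0_cp.
Qed.

(** For nonnegative data, sign changes can only lower the scalar product. *)
Lemma even_orbit_le us (k l m c : R) : 0 <= k -> 0 <= l -> 0 <= m ->
  (forall u, u \in us -> [/\ 0 <= u 0 0, 0 <= u 0 1 & 0 <= u 0 2%:R] /\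
    [/\ k * u 0 0 + l * u 0 1 + m * u 0 2%:R <= c,
        k * u 0 1 + l * u 0 2%:R + m * u 0 0 <= c
      & k * u 0 2%:R + l * u 0 0 + m * u 0 1 <= c]) ->
  forall v, orbits even_signed us v -> dot (pt k l m) v <= c.
Proof.
move=> k0 l0 m0 usP _ [u [s [e [/usP[[u0 u1 u2] [c0 c1 c2]] even ->]]]].
rewrite signed_permE dot_pt; move: (perm3P s); rewrite (negPf even).
by case=> -[-> -> ->]; [apply: le_trans c0|apply: le_trans c1|apply: le_trans c2];
  rewrite !lerD ?ler_sign_mul.
Qed.

(** Besides the diagonal normal [pt 1 1 1], supported by the vertex [pt a b c],
    the polytope has a facet with normal [pt 0 l m]: it contains [pt x y z], the
    mirror image [pt (- x) y z], and a vertex off the line of these two.  As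
    all data are nonnegative, the inequalities need to be checked only at the
    generating vertices and their cyclic images. *)
Theorem pyritohedral_not_decomposable us P (a b c l m x y z x' y' z' : R) :
  0 < l -> 0 < m -> a != b -> x != 0 -> y != y' ->
  pt a b c \in us -> orbits even_signed us (pt x y z) ->
  orbits even_signed us (pt x' y' z') -> l * y' + m * z' = l * y + m * z ->
  (forall u, u \in us -> [/\ 0 <= u 0 0, 0 <= u 0 1 & 0 <= u 0 2%:R] /\
    [/\ u 0 0 + u 0 1 + u 0 2%:R <= a + b + c,
        l * u 0 0 + m * u 0 1 <= l * y + m * z,
        l * u 0 1 + m * u 0 2%:R <= l * y + m * z
      & l * u 0 2%:R + m * u 0 0 <= l * y + m * z]) ->
  Defs.similar (convex_hull (orbits even_signed us)) P ->
  ~ orthogonally_decomposable P.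
Proof.
move=> l0 m0 ab x0 yy' Vabc Vxyz V' eq' usP.
have inv := orbits_tetra_invariant (us := us) tetra_stable_even.
have f1 : facet_normal (orbits even_signed us) (pt 1 1 1).
  apply: (@facet_normal_diagonal _ _ a b c) => //.
    apply: even_orbit_le => // u /usP[u0 [? _ _ _]]; split=> //.
    by rewrite !mul1r; split; lra.
  exact: mem_orbits_even.
have f2 : facet_normal (orbits even_signed us) (pt 0 l m).
  exists (l * y + m * z), (pt x y z), (pt (- x) y z), (pt x' y' z'); split.
  - apply: even_orbit_le; rewrite ?(ltW l0) ?(ltW m0) // => u /usP[u0 [_ ? ? ?]].
    by split=> //; rewrite !mul0r !add0r.
  - by split=> //; exact: orbits_even_reflect.
  - by rewrite !dot_pt !mul0r !add0r.
  - apply: (@aff_indep_minor _ _ _ _ 0 1); rewrite !mxE /= subrr mul0r subr0.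
    by rewrite mulf_neq0 ?subr_eq0 1?eq_sym //; lra.
apply: (tetrahedral_not_decomposable inv f1).
  have finv : tetra_invariant (facet_normal (orbits even_signed us)).
    by move=> s e v se; apply: facet_normal_tetra.
  exact: tetra_cycle f2.
by rewrite expr0n /= subr0 mulf_neq0 ?expf_neq0 ?gt_eqF.
Qed.

Lemma cycle_mem us (x y z : R) : pt x y z \in us -> orbits even_signed us (pt y z x).
Proof.
by move=> /mem_orbits_even; exact: (tetra_cycle (orbits_tetra_invariant tetra_stable_even)).
Qed.

End Pyritohedral.

Section IcosahedralSolids.
Variable R : realType.
Local Notation phi := (phi R).

Lemma phi_facts : [/\ phi ^+ 2 = phi + 1, 8 / 5 < phi, phi < 13 / 8 & phi^-1 = phi - 1].
Proof.
have s : Num.sqrt 5 ^+ 2 = 5 :> R := sqr_sqrtr (ler0n R 5).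
have s0 : 0 <= Num.sqrt 5 :> R := sqrtr_ge0 5.
have lo : 11 / 5 < Num.sqrt 5 :> R by nra.
have hi : Num.sqrt 5 < 9 / 4 :> R by nra.
have e : phi ^+ 2 = phi + 1 by rewrite /Defs.phi; nra.
have p : phi != 0 by rewrite /Defs.phi; lra.
split=> //; try by rewrite /Defs.phi; lra.
by apply: (mulfI p); rewrite mulfV // mulrBr mulr1 -expr2 e; ring.
Qed.

(** In this proof and the five that follow, both facets are perpendicular to
    threefold axes of the icosahedral group, which are the diagonals of the cube
    and the cyclic images of [pt 0 (+-1) (phi + 1)] (or of its transposed form,
    according to the orientation of the coordinates). *)
Lemma regular_icosahedron_not_decomposable (P : set 'rV[R]_3) :
  regular_icosahedron P -> ~ orthogonally_decomposable P.
Proof.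
have [p2 lo hi pV] := phi_facts.
rewrite /regular_icosahedron.
apply: (@pyritohedral_not_decomposable R _ _ 0 1 phi (phi + 1) 1 1 phi 0 0 1 phi);
  try lra; rewrite ?inE ?eqxx //.
- exact/cycle_mem/mem_head.
- exact/mem_orbits_even/mem_head.
- move=> u; rewrite !inE => /eqP ->; rewrite !mxE /=; do 2 split; lra.
Qed.

Lemma icosidodecahedron_not_decomposable (P : set 'rV[R]_3) :
  icosidodecahedron P -> ~ orthogonally_decomposable P.
Proof.
have [p2 lo hi pV] := phi_facts.
have p3 : phi ^+ 3 = 2 * phi + 1 by rewrite exprS p2; lra.
rewrite /icosidodecahedron.
apply: (@pyritohedral_not_decomposable R _ _ 1 phi (phi ^+ 2) 1 (phi + 1)
  1 phi (phi ^+ 2) 0 0 (2 * phi)); try lra; rewrite ?inE ?eqxx ?orbT //.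
- by apply: mem_orbits_even; rewrite !inE eqxx orbT.
- by apply: mem_orbits_even; rewrite !inE eqxx.
- move=> u; rewrite !inE => /orP[]/eqP->; rewrite !mxE /= ?p2; do 2 split; lra.
Qed.

Lemma truncated_dodecahedron_not_decomposable (P : set 'rV[R]_3) :
  truncated_dodecahedron P -> ~ orthogonally_decomposable P.
Proof.
have [p2 lo hi pV] := phi_facts.
rewrite /truncated_dodecahedron pV.
apply: (@pyritohedral_not_decomposable R _ _ phi 2 (phi + 1) 1 (phi + 1)
  (phi - 1) phi (2 * phi) 0 (phi - 1) (2 + phi)); try lra; rewrite ?inE ?eqxx ?orbT //.
- by apply: mem_orbits_even; rewrite !inE eqxx orbT.
- by apply: mem_orbits_even; rewrite !inE eqxx.
- move=> u; rewrite !inE => /or3P[]/eqP->; rewrite !mxE /=; do 2 split; lra.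
Qed.

Lemma truncated_icosahedron_not_decomposable (P : set 'rV[R]_3) :
  truncated_icosahedron P -> ~ orthogonally_decomposable P.
Proof.
have [p2 lo hi pV] := phi_facts.
rewrite /truncated_icosahedron.
apply: (@pyritohedral_not_decomposable R _ _ phi 2 (2 * phi + 1) (phi + 1) 1
  1 (2 + phi) (2 * phi) 1 (3 * phi) 0); try lra; rewrite ?inE ?eqxx ?orbT //.
- by apply: mem_orbits_even; rewrite !inE eqxx orbT.
- exact/cycle_mem/mem_head.
- move=> u; rewrite !inE => /or3P[]/eqP->; rewrite !mxE /=; do 2 split; lra.
Qed.

Lemma truncated_icosidodecahedron_not_decomposable (P : set 'rV[R]_3) :
  truncated_icosidodecahedron P -> ~ orthogonally_decomposable P.
Proof.
have [p2 lo hi pV] := phi_facts.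
rewrite /truncated_icosidodecahedron pV p2.
apply: (@pyritohedral_not_decomposable R _ _ phi 3 (2 * phi) 1 (phi + 1)
  (phi - 1) (phi - 1) (3 + phi) (phi - 1) (phi + 1) (3 * phi - 1)); try lra;
  rewrite ?inE ?eqxx ?orbT //.
- by apply: mem_orbits_even; rewrite !inE eqxx.
- by apply: mem_orbits_even; rewrite !inE eqxx ?orbT.
- move=> u; rewrite !inE => /or4P[|||/orP[]]/eqP->; rewrite !mxE /=; do 2 split; lra.
Qed.

Lemma rhombicosidodecahedron_not_decomposable (P : set 'rV[R]_3) :
  rhombicosidodecahedron P -> ~ orthogonally_decomposable P.
Proof.
have [p2 lo hi pV] := phi_facts.
have p3 : phi ^+ 3 = 2 * phi + 1 by rewrite exprS p2; lra.
rewrite /rhombicosidodecahedron p3 p2.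
apply: (@pyritohedral_not_decomposable R _ _ (phi + 1) phi (2 * phi) 1 (phi + 1)
  1 1 (2 * phi + 1) 0 (phi + 1) (2 + phi)); try lra; rewrite ?inE ?eqxx ?orbT //.
- by apply: mem_orbits_even; rewrite !inE eqxx.
- by apply: cycle_mem; rewrite !inE eqxx ?orbT.
- move=> u; rewrite !inE => /or3P[]/eqP->; rewrite !mxE /=; do 2 split; lra.
Qed.

End IcosahedralSolids.

(** * The other solids *)

Section OtherSolids.
Variable R : realType.
Local Notation E3 := 'rV[R]_3.
Implicit Types (us : seq E3) (s : 'S_3) (e : {ffun 'I_3 -> bool}).

(** Bounds the scalar product of [pt k l m] with the images of [pt x y z] under
    the sign changes in the tetrahedral group; those outside of it are reached
    by negating [x], [y] and [z]. *)
Definition tetra_le (k l m c x y z : R) :=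
  [/\ k * x + l * y + m * z <= c, k * x - l * y - m * z <= c,
      - (k * x) + l * y - m * z <= c & - (k * x) - l * y + m * z <= c].

Lemma odd_signs3 e : odd_signs e = e 0 (+) e 1 (+) e 2%:R.
Proof.
rewrite /odd_signs !big_ord_recl big_ord0 addbF addbA.
by congr (e _ (+) e _ (+) e _); apply/val_inj.
Qed.

Lemma signed_perm_even_le s e (u : E3) (k l m c : R) : ~~ odd_signs e ->
  tetra_le k l m c (u 0 (s 0)) (u 0 (s 1)) (u 0 (s 2%:R)) ->
  dot (pt k l m) (signed_perm s e u) <= c.
Proof.
rewrite odd_signs3 signed_permE dot_pt => + [].
by case: (e 0) (e 1) (e 2%:R) => -[] [] //= _ *;
  rewrite ?expr0 ?expr1 ?mul1r ?mulN1r ?mulrN.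
Qed.

Lemma signed_perm_odd_le s e (u : E3) (k l m c : R) : odd_signs e ->
  tetra_le k l m c (- u 0 (s 0)) (- u 0 (s 1)) (- u 0 (s 2%:R)) ->
  dot (pt k l m) (signed_perm s e u) <= c.
Proof.
rewrite odd_signs3 signed_permE dot_pt /tetra_le !mulrN !opprK => + [].
by case: (e 0) (e 1) (e 2%:R) => -[] [] //= _ *;
  rewrite ?expr0 ?expr1 ?mul1r ?mulN1r ?mulrN.
Qed.

Lemma tetrahedral_orbit_le us (k l m c : R) :
  (forall u, u \in us -> [/\ tetra_le k l m c (u 0 0) (u 0 1) (u 0 2%:R),
     tetra_le k l m c (u 0 1) (u 0 2%:R) (u 0 0)
   & tetra_le k l m c (u 0 2%:R) (u 0 0) (u 0 1)]) ->
  forall v, orbits tetrahedral_rot us v -> dot (pt k l m) v <= c.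
Proof.
move=> usP _ [u [s [e [/usP[u1 u2 u3] /andP[se ee] ->]]]].
apply: signed_perm_even_le => //.
by move: (perm3P s); rewrite (negPf se) => -[] [-> -> ->].
Qed.

Lemma octahedral_orbit_le us (k l m c : R) :
  (forall u, u \in us -> [/\ tetra_le k l m c (u 0 0) (u 0 1) (u 0 2%:R),
     tetra_le k l m c (u 0 1) (u 0 2%:R) (u 0 0)
   & tetra_le k l m c (u 0 2%:R) (u 0 0) (u 0 1)]) ->
  (forall u, u \in us ->
    [/\ tetra_le k l m c (- u 0 0) (- u 0 2%:R) (- u 0 1),
     tetra_le k l m c (- u 0 1) (- u 0 0) (- u 0 2%:R)
   & tetra_le k l m c (- u 0 2%:R) (- u 0 1) (- u 0 0)]) ->
  forall v, orbits octahedral_rot us v -> dot (pt k l m) v <= c.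
Proof.
move=> usP usP' _ [u [s [e [uus /eqP se ->]]]].
have [u1 u2 u3] := usP _ uus; have [u1' u2' u3'] := usP' _ uus.
move: (perm3P s); rewrite se; case: ifP => ee sP.
  by apply: signed_perm_odd_le => //; case: sP => -[-> -> ->].
by apply: signed_perm_even_le; rewrite ?ee //; case: sP => -[-> -> ->].
Qed.

Lemma rhombicuboctahedron_not_decomposable (P : set 'rV[R]_3) :
  rhombicuboctahedron P -> ~ orthogonally_decomposable P.
Proof.
rewrite /rhombicuboctahedron; set w := 1 + _.
have w1 : 1 < w by rewrite /w ltrDl sqrtr_gt0.
set V := orbits _ _.
have inv : tetra_invariant V by apply: orbits_tetra_invariant; exact: tetra_stable_all.
have evenV v : orbits even_signed [:: pt 1 1 w] v -> V v.
  by move=> [u [s [e [uus _ ->]]]]; exists u, s, e.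
have V1 : V (pt 1 1 w) by exact/evenV/mem_orbits_even/mem_head.
have V2 : V (pt w 1 1) by exact: (tetra_cycle inv (tetra_cycle inv V1)).
have V3 : V (pt 1 (- 1) w).
  apply: (tetra_cycle inv); apply: (tetra_cycle inv).
  apply/evenV/orbits_even_reflect/cycle_mem; exact: mem_head.
have le k l m c : 0 <= k -> 0 <= l -> 0 <= m ->
  k + l + m * w <= c -> k + l * w + m <= c -> k * w + l + m <= c ->
    forall v, V v -> dot (pt k l m) v <= c.
  move=> k0 l0 m0 c1 c2 c3 v [u [s [e [+ _ ->]]]]; rewrite inE => /eqP->.
  rewrite signed_permE dot_pt.
  have u0 i : 0 <= (pt 1 1 w) 0 i by rewrite mxE; case: (ord3P i) => -> /=; lra.
  apply: (@le_trans _ _ (k * (pt 1 1 w) 0 (s 0) + l * (pt 1 1 w) 0 (s 1) +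
    m * (pt 1 1 w) 0 (s 2%:R))).
    by rewrite !lerD ?ler_sign_mul.
  move: (perm3P s); case: odd_perm => -[] [-> -> ->]; rewrite !mxE /=; lra.
have f1 : facet_normal V (pt 1 1 1).
  apply: (@facet_normal_diagonal _ _ w 1 1) => //; last by rewrite gt_eqF.
  by apply: le; lra.
have f2 : facet_normal V (pt 1 0 1).
  exists (1 + w), (pt 1 1 w), (pt 1 (- 1) w), (pt w 1 1); split=> //.
  - by apply: le; lra.
  - by rewrite !dot_pt; split; ring.
  - by apply: (@aff_indep_minor _ _ _ _ 0 1); rewrite !mxE /=; lra.
by apply: (tetrahedral_not_decomposable inv f1 f2); lra.
Qed.

(** The second facet is one of the 24 triangles that are not on a threefold
    axis; its normal is, up to sign, the cross product of two sides divided
    by [t - 1].  All quantities are written as combinations of [1], [t] and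
    [t ^+ 2], which makes the inequalities linear. *)
Lemma snub_cube_not_decomposable (P : set 'rV[R]_3) :
  snub_cube P -> ~ orthogonally_decomposable P.
Proof.
move=> [t t3]; set V := orbits _ _.
(* The cofactor of [t - t0] in the difference of the values of the cubic at
   [t] and at a rational [t0] is positive definite. *)
have lo : 9 / 5 < t.
  rewrite ltNge; apply/negP => le.
  have q : 0 < t ^+ 2 + 4 / 5 * t + 11 / 25.
    have := sqr_ge0 (t + 2 / 5); lra.
  have : (t - 9 / 5) * (t ^+ 2 + 4 / 5 * t + 11 / 25) <= 0.
    by apply: mulr_le0_ge0; lra.
  lra.
have hi : t < 15 / 8.
  rewrite ltNge; apply/negP => le.
  have q : 0 < t ^+ 2 + 7 / 8 * t + 41 / 64.
    have := sqr_ge0 (t + 7 / 16); lra.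
  have : 0 <= (t - 15 / 8) * (t ^+ 2 + 7 / 8 * t + 41 / 64).
    by apply: mulr_ge0; lra.
  lra.
have t2 : 16 / 5 <= t ^+ 2 <= 18 / 5 by nra.
move: t2 => /andP[t2l t2h].
have t4 : t ^+ 4 = 2 * t ^+ 2 + 2 * t + 1.
  by rewrite exprS t3; lra.
have tV : t^-1 = t ^+ 2 - t - 1.
  have t0 : t != 0 by lra.
  by apply: (mulfI t0); rewrite mulfV //; lra.
have inv : tetra_invariant V by apply: orbits_tetra_invariant; exact: tetra_stable_octahedral.
have V1 : V (pt 1 t^-1 t).
  by apply: mem_orbits; rewrite ?mem_head // /octahedral_rot odd_perm1 odd_signs3 !ffunE.
have V2 : V (pt t^-1 t 1) := tetra_cycle inv V1.
have V3 : V (pt (- t^-1) 1 t).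
  pose s : 'S_3 := tperm 0 1; exists (pt 1 t^-1 t), s, [ffun i => i == 0]; split.
  - exact: mem_head.
  - by rewrite /octahedral_rot odd_tperm odd_signs3 !ffunE.
  - by rewrite signed_permE /s !permE /= !ffunE !mxE /= expr1 !expr0 !mul1r mulN1r.
rewrite {}/V tV in inv V1 V2 V3 *; set V := orbits _ _ in inv V1 V2 V3 *.
have f1 : facet_normal V (pt 1 1 1).
  apply: (@facet_normal_diagonal _ _ _ _ _ inv _ V1); last by lra.
  apply: octahedral_orbit_le => u; rewrite inE => /eqP ->; rewrite !mxE /=; do 2 split; lra.
have f2 : facet_normal V (pt (2 + t - t ^+ 2) (t ^+ 2 - t) (3 * t - t ^+ 2)).
  exists (2 + t - t ^+ 2 + (t ^+ 2 - t) * (t ^+ 2 - t - 1) + (3 * t - t ^+ 2) * t).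
  exists (pt 1 (t ^+ 2 - t - 1) t), (pt (t ^+ 2 - t - 1) t 1), (pt (- (t ^+ 2 - t - 1)) 1 t).
  split=> //.
  - apply: octahedral_orbit_le => u; rewrite inE => /eqP ->; rewrite !mxE /=; do 2 split; lra.
  - by rewrite !dot_pt; split; lra.
  - by apply: (@aff_indep_minor _ _ _ _ 1 2%:R); rewrite !mxE /=; nra.
apply: (tetrahedral_not_decomposable inv f1 f2).
rewrite subr_sqr !mulf_neq0 //; lra.
Qed.

Local Notation phi := (phi R).

(** As the inverse of [x] is [(phi - 1) * (x ^+ 2 - 2)], the coordinates are
    integer combinations of [1, phi, x, y, z, w]. *)
Lemma snub_dodecahedron_pointsE (x y z w : R) : x ^+ 3 - 2 * x = phi ->
  y = phi * x -> z = x ^+ 2 -> w = phi * x ^+ 2 ->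
  snub_dodecahedron_points x =
  [:: pt (-4 + 4 * phi + 2 * x + 2 * z - 2 * w) 2 (-2 + 2 * phi + 2 * y + 2 * z);
      pt (2 * phi + 2 * x) (-4 + 2 * phi + 2 * z) (4 - 2 * phi + 2 * y - 2 * z + 2 * w);
      pt (2 * x) (2 - 2 * z) (6 - 2 * phi + 2 * y - 2 * z + 2 * w);
      pt (-2 + 2 * phi + 2 * x + 2 * z) (4 - 4 * phi - 2 * z + 2 * w) (2 + 2 * y);
      pt (-4 + 2 * phi + 2 * x + 2 * z) (-4 + 2 * phi + 2 * z - 2 * w) (2 * phi + 2 * y)].
Proof.
move=> x3 yE zE wE; have [p2 plo phi_hi pV] := @phi_facts R.
have x0 : x != 0.
  by apply/eqP => x0; move: x3; rewrite x0 expr0n /=; lra.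
rewrite -zE in wE.
have zp : phi * z = w by [].
have wp : phi * w = w + z.
  by transitivity (phi ^+ 2 * z); [rewrite wE | rewrite p2 wE]; ring.
have xp : phi * x = y by [].
have yp : phi * y = y + x.
  by transitivity (phi ^+ 2 * x); [rewrite yE | rewrite p2 yE]; ring.
have xV : x^-1 = w - z - 2 * phi + 2.
  apply: (mulfI x0); rewrite mulfV // wE zE.
  transitivity (x ^+ 3 * (phi - 1) - 2 * x * (phi - 1)); last by ring.
  have -> : x ^+ 3 = phi + 2 * x by lra.
  by lra.
have xpp : phi ^+ 2 * x = y + x by rewrite p2 -xp; ring.
have wpp : phi ^+ 2 * w = 2 * w + z by rewrite p2 mulrDl wp; ring.
have zpp : phi ^+ 2 * z = w + z by rewrite p2 -zp; ring.
have p3 : phi ^+ 3 = 2 * phi + 1 by rewrite exprS p2; lra.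
rewrite /snub_dodecahedron_points xV pV; clear - p2 zp wp xp yp xpp wpp zpp p3.
by congr [:: _; _; _; _; _]; congr pt; lra.
Qed.

(** The second facet is the pentagon with normal [pt 0 phi 1]; three of its
    vertices are cyclic images of the first three generating points.  With the
    monomials of [phi] and [x] named, all inequalities are linear, and follow
    from numerical bounds on these monomials. *)
Lemma snub_dodecahedron_not_decomposable (P : set 'rV[R]_3) :
  snub_dodecahedron P -> ~ orthogonally_decomposable P.
Proof.
move=> [x x3].
have [p2 plo phi_hi pV] := @phi_facts R.
have lo : 17 / 10 < x.
  rewrite ltNge; apply/negP => le.
  have q : 0 < x ^+ 2 + 17 / 10 * x + 89 / 100.
    have := sqr_ge0 (x + 17 / 20); lra.
  have : (x - 17 / 10) * (x ^+ 2 + 17 / 10 * x + 89 / 100) <= 0.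
    by apply: mulr_le0_ge0; lra.
  lra.
have hi : x < 7 / 4.
  rewrite ltNge; apply/negP => le.
  have q : 0 < x ^+ 2 + 7 / 4 * x + 17 / 16.
    have := sqr_ge0 (x + 7 / 8); lra.
  have : 0 <= (x - 7 / 4) * (x ^+ 2 + 7 / 4 * x + 17 / 16).
    by apply: mulr_ge0; lra.
  lra.
have [y yE] : exists y, y = phi * x by exists (phi * x).
have [z zE] : exists z, z = x ^+ 2 by exists (x ^+ 2).
have [w wE] : exists w, w = phi * x ^+ 2 by exists (phi * x ^+ 2).
rewrite (snub_dodecahedron_pointsE x3 yE zE wE).
have zlo : 14 / 5 < z by nra.
have zhi : z < 31 / 10 by nra.
have ylo : 27 / 10 < y by nra.
have yhi : y < 29 / 10 by nra.
rewrite -zE in wE.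
have wlo : 22 / 5 < w by nra.
have whi : w < 51 / 10 by nra.
have yp : phi * y = y + x.
  by transitivity (phi ^+ 2 * x); [rewrite yE | rewrite p2 yE]; ring.
have wp : phi * w = w + z.
  by transitivity (phi ^+ 2 * z); [rewrite wE | rewrite p2 wE]; ring.
move: yE wE {zE x3 pV} => /esym xp /esym zp.
set us := [:: _; _; _; _; _]; set V := orbits _ _.
have inv : tetra_invariant V by apply: orbits_tetra_invariant; exact: tetra_stable_tetrahedral.
have inV u : u \in us -> V u.
  by move=> uus; apply: mem_orbits; rewrite // /tetrahedral_rot odd_perm1 odd_signs3 !ffunE.
have Vcyc a b c : pt a b c \in us -> V (pt b c a).
  by move=> /inV; exact: (@tetra_cycle _ V a b c inv).
have f1 : facet_normal V (pt 1 1 1).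
  apply: (@facet_normal_diagonal _ _ (2 * phi + 2 * x) (-4 + 2 * phi + 2 * z)
    (4 - 2 * phi + 2 * y - 2 * z + 2 * w) inv).
  - apply: tetrahedral_orbit_le => u; rewrite !inE => /or4P[|||/orP[]] /eqP ->; rewrite !mxE /=;
      do 2 split; lra.
  - by apply: inV; rewrite !inE eqxx ?orbT.
  - by lra.
have f2 : facet_normal V (pt 0 phi 1).
  exists (-2 + 4 * phi + 4 * x + 2 * y + 2 * z).
  exists (pt 2 (-2 + 2 * phi + 2 * y + 2 * z) (-4 + 4 * phi + 2 * x + 2 * z - 2 * w)).
  exists (pt (-4 + 2 * phi + 2 * z) (4 - 2 * phi + 2 * y - 2 * z + 2 * w) (2 * phi + 2 * x)).
  exists (pt (2 - 2 * z) (6 - 2 * phi + 2 * y - 2 * z + 2 * w) (2 * x)); split.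
  - apply: tetrahedral_orbit_le => u; rewrite !inE => /or4P[|||/orP[]] /eqP ->; rewrite !mxE /=;
      do 2 split; lra.
  - by split; apply: Vcyc; rewrite !inE eqxx ?orbT.
  - by rewrite !dot_pt; split; lra.
  - apply: (@aff_indep_minor _ _ _ _ 0 1); rewrite !mxE /= lt_eqF // subr_lt0.
    have pz : 0 < (2 - phi) * (z - 2) by apply: mulr_gt0; lra.
    apply: (@lt_trans _ _ 0); first by rewrite pmulr_rlt0; lra.
    by rewrite nmulr_rgt0; lra.
apply: (tetrahedral_not_decomposable inv f1).
  have finv : tetra_invariant (facet_normal V).
    by move=> s e v se; apply: facet_normal_tetra.
  exact: (tetra_cycle finv f2).
by lra.
Qed.

End OtherSolids.

Theorem corollary6p2 (R : realType) :
  (forall P : set 'rV[R]_3,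
     regular_icosahedron P -> ~ orthogonally_decomposable P) /\
  (forall P : set 'rV[R]_3,
     rhombicuboctahedron P -> ~ orthogonally_decomposable P) /\
  (forall P : set 'rV[R]_3,
     icosidodecahedron P -> ~ orthogonally_decomposable P) /\
  (forall P : set 'rV[R]_3,
     truncated_dodecahedron P -> ~ orthogonally_decomposable P) /\
  (forall P : set 'rV[R]_3,
     truncated_icosahedron P -> ~ orthogonally_decomposable P) /\
  (forall P : set 'rV[R]_3,
     truncated_icosidodecahedron P -> ~ orthogonally_decomposable P) /\
  (forall P : set 'rV[R]_3,
     rhombicosidodecahedron P -> ~ orthogonally_decomposable P) /\
  (forall P : set 'rV[R]_3,
     snub_cube P -> ~ orthogonally_decomposable P) /\
  (forall P : set 'rV[R]_3,
     snub_dodecahedron P -> ~ orthogonally_decomposable P).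
Proof.
split; first exact: regular_icosahedron_not_decomposable.
split; first exact: rhombicuboctahedron_not_decomposable.
split; first exact: icosidodecahedron_not_decomposable.
split; first exact: truncated_dodecahedron_not_decomposable.
split; first exact: truncated_icosahedron_not_decomposable.
split; first exact: truncated_icosidodecahedron_not_decomposable.
split; first exact: rhombicosidodecahedron_not_decomposable.
split; first exact: snub_cube_not_decomposable.
exact: snub_dodecahedron_not_decomposable.
Qed.
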